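(* Let $G$ be ${\mathbb Z}_{\geq 0}$ or ${\mathbb Z}$, let $X$ be a compact metrizable space with metric $\rho$, and let $T:X\to X$ be a surjective continuous map (a homeomorphism if $G={\mathbb Z}$). Suppose that $k\geq 2$ and $(x_1,\dots,x_k)$ is an IE-tuple in $X^k\setminus\Delta_k(X)$. For each $1\le j\le k$ let $A_j$ be a neighbourhood of $x_j$. Then there exist a $\delta>0$ and, for each $j=1,\dots,k$, a Cantor set $Z_j\subseteq A_j$ such that, with $Z:=\bigcup_j Z_j$: (1) every nonempty finite tuple of points in $Z$ is an IE-tuple; (2) for all $m\in{\mathbb N}$, all distinct $y_1,\dots,y_m\in Z$, and all $y_1',\dots,y_m'\in Z$, one has $\liminf_{n\to\infty}\max_{1\le i\le m}\rho(T^ny_i,y_i')=0$.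
   Context: $\Delta_k(X)=\{(x,\dots,x):x\in X\}$. For a tuple $(A_1,\dots,A_l)$ of subsets of $X$, $J\subseteq G$ is an independence set if for every nonempty finite $I\subseteq J$ and $\sigma:I\to\{1,\dots,l\}$, $\bigcap_{s\in I}T^{-s}A_{\sigma(s)}\neq\emptyset$. A set $I\subseteq{\mathbb Z}$ has positive density if $\lim_n|I\cap\{-n,\dots,n\}|/(2n+1)$ exists and is nonzero; $I\subseteq{\mathbb Z}_{\ge0}$ has positive density if $\lim_n|I\cap\{0,\dots,n\}|/(n+1)$ exists and is nonzero. A tuple $(x_1,\dots,x_l)\in X^l$ (any $l\ge1$) is an IE-tuple if for every product neighbourhood $U_1\times\cdots\times U_l$ of it, $(U_1,\dots,U_l)$ has an independence set of positive density. *)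

(* Defs.v *)
From HB Require Import structures.
From mathcomp Require Import all_boot all_order all_algebra.
From mathcomp Require Import all_classical all_reals all_analysis.
Set Implicit Arguments. Unset Strict Implicit. Unset Printing Implicit Defensive.
Import Order.TTheory GRing.Theory Num.Theory.
Import numFieldNormedType.Exports.
Local Open Scope classical_set_scope.
Local Open Scope ring_scope.

Definition is_compatible_metric (R : realType) (X : topologicalType)
    (rho : X -> X -> R) : Prop :=
  [/\ forall x y, rho x y = 0 <-> x = y,
      forall x y, rho x y = rho y x,
      forall x y z, rho x z <= rho x y + rho y z &
      forall (x : X) (U : set X),
        nbhs x U <-> exists2 e : R, 0 < e & [set y | rho x y < e] `<=` U].

Definition Gset (isZ : bool) : set int :=
  if isZ then [set: int] else [set n : int | (0 <= n)%R].

(* T^n for n : int, using the inverse Tinv for negative n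
   (only relevant when G = Z, where T is a homeomorphism with inverse Tinv). *)
Definition actZ (X : Type) (T Tinv : X -> X) (n : int) (x : X) : X :=
  match n with
  | Posz k => iter k T x
  | Negz k => iter k.+1 Tinv x
  end.

Definition independence_set (X : Type) (T Tinv : X -> X) (isZ : bool)
    (l : nat) (A : 'I_l -> set X) (J : set int) : Prop :=
  J `<=` Gset isZ /\
  forall (I : set int) (sigma : int -> 'I_l),
    finite_set I -> I !=set0 -> I `<=` J ->
    (\bigcap_(s in I) (actZ T Tinv s @^-1` A (sigma s))) !=set0.

Definition count_sym (I : set int) (n : nat) : nat :=
  \sum_(i < (n.*2).+1) (((i%:Z - n%:Z)%R \in I) : nat).
Definition count_pos (I : set int) (n : nat) : nat :=
  \sum_(i < n.+1) ((i%:Z \in I) : nat).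

Definition positive_density (R : realType) (isZ : bool) (I : set int) : Prop :=
  if isZ then
    exists2 d : R, d != 0 &
      (fun n : nat => (count_sym I n)%:R / (n.*2).+1%:R : R) @ \oo --> d
  else
    I `<=` Gset false /\
    exists2 d : R, d != 0 &
      (fun n : nat => (count_pos I n)%:R / n.+1%:R : R) @ \oo --> d.

Definition IE_tuple (R : realType) (X : topologicalType) (T Tinv : X -> X)
    (isZ : bool) (l : nat) (x : 'I_l -> X) : Prop :=
  forall U : 'I_l -> set X, (forall i, nbhs (x i) (U i)) ->
    exists J : set int,
      independence_set T Tinv isZ U J /\ positive_density R isZ J.

Definition is_cantor_set (X : topologicalType) (Z : set X) : Prop :=
  exists f : cantor_space -> X,
    [/\ continuous f, injective f, f @` [set: cantor_space] = Z &
        exists g : X -> cantor_space,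
          (forall c, g (f c) = c) /\ {within Z, continuous g}].

(* Main.v *)
Require Import Defs.
From HB Require Import structures.
From mathcomp Require Import all_boot all_order all_algebra.
From mathcomp Require Import all_classical all_reals all_analysis.
From mathcomp Require Import zify ring lra.
Set Implicit Arguments.
Unset Strict Implicit.
Unset Printing Implicit Defensive.

(** Call a finite family of sets positively independent if there is [c > 0] such
    that every window [0, n) contains an independence set of size at least
    [c * n]. Cutting windows into translates and taking an ultrafilter limit
    shows that this is the same as having an independence set whose density
    exists and is positive; independence sets in the integers can be moved to
    nonnegative times by translation.

    Positive independence survives two operations. If one member of the family
    is covered by finitely many pieces, it can be replaced by one of them: this
    is a Sauer--Shelah type counting argument for words whose letters carry a
    label. And for any self-map [g] of the index set there are arbitrarily large
    times [f] such that each [A i] can be replaced by the set of points of [A i]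
    which [T^f] sends to [A (g i)]: many pairs of elements of an independence set
    have the same difference [f].

    Start from small closed neighbourhoods of the points, two of them disjoint,
    double the index set, apply the second operation to all self-maps and the
    first one to make all diameters small, and iterate. The branches of the
    resulting tree of closed sets are the points of the Cantor sets. Different
    nodes are disjoint because a suitable return time separates them, tuples are
    IE-tuples because every level is positively independent, and the returns
    along all self-maps give the statement on the lower limit. *)

(** * Counting words of a given length *)

Section WordCount.
Variable E : finType.

(** Recursing on the first letter makes the sections of [S] available to every induction below. *)
Fixpoint word_count (n : nat) (S : pred (seq E)) : nat :=
  if n is n'.+1 then \sum_x word_count n' (fun s => S (x :: s)) else S [::].

Lemma eq_word_count n (S S' : pred (seq E)) :
  S =1 S' -> word_count n S = word_count n S'.
Proof.
elim: n S S' => [|n IH] S S' eqS /=; first by rewrite eqS.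
by apply: eq_bigr => x _; apply: IH => s; rewrite eqS.
Qed.

Lemma word_count_gt0 n (S : pred (seq E)) :
  0 < word_count n S -> exists2 s, size s = n & S s.
Proof.
elim: n S => [|n IH] S /=; first by case h : (S [::]) => // _; exists [::].
rewrite lt0n sum_nat_eq0 negb_forall => /existsP[x].
rewrite implyTb -lt0n => /IH[s sn Ss].
by exists (x :: s) => //=; rewrite sn.
Qed.

Lemma sum_word_count_fiber (P : finType) n (f : seq E -> P) (S : pred (seq E)) :
  \sum_p word_count n (fun s => (f s == p) && S s) = word_count n S.
Proof.
elim: n f S => [|n IH] f S /=.
  rewrite (bigD1 (f [::])) //= eqxx big1 ?addn0 // => p.
  by rewrite eq_sym => /negbTE ->.
by rewrite exchange_big; apply: eq_bigr => x _; rewrite IH.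
Qed.

(* A word lying in all the [S a] is counted [#|L|] times on the left, any other
   word of their union at most [#|L| - 1] times. *)
Lemma sum_word_count_le (L : finType) n (S : L -> pred (seq E)) :
  \sum_a word_count n (S a) <=
  #|L|.-1 * word_count n (fun s => [exists a, S a s]) +
  word_count n (fun s => [forall a, S a s]).
Proof.
elim: n S => [|n IH] S /=; last first.
  rewrite exchange_big big_distrr -big_split /=.
  by apply: leq_sum => x _; apply: IH.
have [/forallP Sall|] := boolP [forall a, S a [::]].
  have [L0|/card_gt0P[a0 _]] := posnP #|L|.
    by rewrite big1 // => a; have := card0_eq L0 a.
  have -> : [exists a, S a [::]] by apply/existsP; exists a0.
  rewrite muln1 addn1 prednK; last by apply/card_gt0P; exists a0.
  by rewrite -sum1_card; apply: leq_sum => a _; case: (S a _).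
rewrite negb_forall => /existsP[a nSa].
have [|] := boolP [exists a, S a [::]]; last first.
  rewrite negb_exists => /forallP nS.
  by rewrite big1 // => b _; rewrite (negbTE (nS b)).
rewrite muln1 addn0 (bigD1 a) //= (negbTE nSa) add0n => _.
rewrite -(cardC1 a) -sum1_card; apply: leq_sum => b _.
by case: (S b _).
Qed.

End WordCount.

(** * A shattering lemma for words with labelled letters *)

Section Shattering.
Variables L P : finType.
Implicit Type S : pred (seq (L * P)).

(** The label at a position of [W] may depend on that position and its own letter, but not on the
    rest of the word. *)
Definition shatters (e0 : L * P) n S (W : pred nat) :=
  exists D : nat -> L -> P, forall tau : nat -> L,
    exists2 s, size s = n & S s /\
      forall i, i < n -> W i -> nth e0 s i = (tau i, D i (tau i)).

Lemma count_iota_cons (b : bool) (W : pred nat) n :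
  count (fun i => if i is j.+1 then W j else b) (iota 0 n.+1) =
  b + count W (iota 0 n).
Proof.
by rewrite -[iota 0 n.+1]/(0 :: iota (1 + 0) n) iotaDl /= count_map.
Qed.

(* A version of the Sauer--Shelah--Karpinski--Meshulam lemma, for words whose
   letters carry a second component: after restricting each letter [a] to its
   most frequent label [p], the sections [S (a, p)] of [S] along the first
   position are handled through their union and their intersection. *)
Lemma shatters_large (e0 : L * P) n S d :
  (#|P|.*2) ^ d * (#|P|.*2 * #|L|.-1).+1 ^ n < 2 ^ n * word_count n S ->
  exists2 W, d < count W (iota 0 n) & shatters e0 n S W.
Proof.
set u := #|P|.*2; set M := (u * _).+1.
have P_gt0 : 0 < #|P| by apply/card_gt0P; exists e0.2.
have u_gt0 : 0 < u by rewrite /u double_gt0.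
elim: n S d => [|n IH] S d.
  rewrite !expn0 muln1 mul1n /= => lt1.
  have := leq_ltn_trans (_ : 1 <= u ^ d) lt1.
  by rewrite expn_gt0 u_gt0 => /(_ isT); case: (S [::]).
pose c a p := word_count n (fun s => S ((a, p) :: s)).
pose pm a := [arg max_(p > e0.2) c a p].
have pmP a p : c a p <= c a (pm a).
  by rewrite /pm; case: arg_maxnP => // q _; apply.
pose SU s := [exists a, S ((a, pm a) :: s)].
pose SI s := [forall a, S ((a, pm a) :: s)].
have cntS : word_count n.+1 S <=
    #|P| * (#|L|.-1 * word_count n SU + word_count n SI).
  apply: (@leq_trans (#|P| * \sum_a c a (pm a))); last first.
    by rewrite leq_mul2l; apply/orP; right; exact: sum_word_count_le.
  rewrite /= (eq_bigr (fun x => c x.1 x.2)) => [|[a p] _ //].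
  rewrite -(pair_bigA _ c) /= big_distrr /=; apply: leq_sum => a _.
  by rewrite -sum_nat_const; apply: leq_sum => p _.
move=> Hlt.
(* If the union is large, the first position stays outside [W]. Otherwise the intersection is large
   and the first position joins [W], paying for one factor [u]; when [d] is 0 it suffices alone. *)
have [/IH[W dW [D DP]]|HU] := boolP (u ^ d * M ^ n < 2 ^ n * word_count n SU).
  exists (fun i => if i is j.+1 then W j else false).
    by rewrite count_iota_cons.
  exists (fun i => if i is j.+1 then D j else fun=> e0.2) => tau.
  have [s sn [/existsP[a Sas] sP]] := DP (tau \o succn).
  exists ((a, pm a) :: s); first by rewrite /= sn.
  by split=> // -[|i] //; apply: sP.
have HI : u ^ d * M ^ n < u * (2 ^ n * word_count n SI).
  move: HU Hlt; rewrite -leqNgt !expnS => HU Hlt.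
  have {Hlt} := leq_trans Hlt (leq_mul (leqnn _) cntS).
  move: HU; rewrite (mulnCA _ M); set e := u ^ d * M ^ n.
  set A := 2 ^ n * _ SU => HU.
  have -> : 2 * 2 ^ n * (#|P| * (#|L|.-1 * word_count n SU + word_count n SI)) =
    u * #|L|.-1 * A + u * (2 ^ n * word_count n SI).
    rewrite /A /u -muln2; nia.
  rewrite /M mulSn; have := leq_mul (leqnn (u * #|L|.-1)) HU; lia.
case: d HI {Hlt HU} => [|d] HI.
  have /word_count_gt0[s sn /forallP SIs] : 0 < word_count n SI.
    by move: HI; case: (word_count n SI) => //; rewrite !muln0.
  exists (fun i => if i is j.+1 then false else true).
    by rewrite count_iota_cons.
  exists (fun=> pm) => tau; exists ((tau 0, pm (tau 0)) :: s).
    by rewrite /= sn.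
  by split=> // -[|i].
move: HI; rewrite expnS -mulnA ltn_pmul2l // => /IH[W dW [D DP]].
exists (fun i => if i is j.+1 then W j else true).
  by rewrite count_iota_cons.
exists (fun i => if i is j.+1 then D j else pm) => tau.
have [s sn [/forallP Sas sP]] := DP (tau \o succn).
exists ((tau 0, pm (tau 0)) :: s); first by rewrite /= sn.
by split=> // -[|i] //; apply: sP.
Qed.

(** [g] forces the label of each occurrence of [j] from the underlying word; the labels of all other
    letters are free, which keeps the set large. *)
Definition labelled (j : L) (e0 : L * P) n (g : seq L -> nat -> P) :
    pred (seq (L * P)) :=
  fun s => all (fun i => let x := nth e0 s i in
    (x.1 == j) ==> (g (map fst s) i == x.2)) (iota 0 n).

(** Each position offers [j] with a forced label or another letter with any label. Although [g] sees
    the whole word, a first letter [j] has exactly one fitting label for each remainder. *)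
Lemma word_count_labelled j e0 n g :
  word_count n (labelled j e0 n g) = (#|P| * #|L|.-1).+1 ^ n.
Proof.
elim: n g => [|n IH] g //=.
pose g' a (t : seq L) i := g (a :: t) i.+1.
rewrite (eq_bigr (fun x => word_count n (fun s =>
    ((x.1 == j) ==> (g (x.1 :: map fst s) 0 == x.2)) &&
    labelled j e0 n (g' x.1) s))); last first.
  move=> x _; apply: eq_word_count => s; rewrite /labelled /=.
  by congr andb; rewrite (iotaDl 1 0) all_map.
rewrite -(pair_bigA _ (fun a p => word_count n (fun s =>
    ((a == j) ==> (g (a :: map fst s) 0 == p)) && labelled j e0 n (g' a) s))) /=.
rewrite (bigD1 j) //= expnS mulSn; congr addn.
  rewrite -(IH (g' j)).
  rewrite -[RHS](sum_word_count_fiber n (fun s => g (j :: map fst s) 0)).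
  by apply: eq_bigr => p _; apply: eq_word_count => s; rewrite eqxx.
rewrite (eq_bigr (fun=> #|P| * (#|P| * #|L|.-1).+1 ^ n)) => [|a ja].
  by rewrite sum_nat_const cardC1 mulnCA mulnA.
rewrite -sum_nat_const; apply: eq_bigr => p _.
by rewrite -(IH (g' a)); apply: eq_word_count => s; rewrite (negbTE ja).
Qed.

End Shattering.

(** Bernoulli's inequality for (1 + 1/M)^n with n = M u. *)
Lemma ltn_exp_succ u M : 0 < M -> u * M ^ (M * u) < M.+1 ^ (M * u).
Proof.
have bern n : M ^ n * M + n * M ^ n <= M.+1 ^ n * M.
  elim: n => [|n IH]; first by rewrite mul0n addn0.
  have := leq_mul (leqnn M.+1) IH; rewrite !expnS; nia.
move=> M0; rewrite -(ltn_pmul2r M0) (leq_trans _ (bern _)) //.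
have : 0 < M ^ (M * u) by rewrite expn_gt0 M0.
set m := M ^ _; nia.
Qed.

(** Shatters the set [labelled]: 2^n times its size is (M + 1)^n, which beats M^n by enough to pay
    for about n / (M u) positions. There the letters are arbitrary and the label of [j] depends on
    the position only. *)
Lemma labelled_sampling (L P : finType) (j : L) (p0 : P) :
  exists2 Q, 0 < Q & forall n (g : seq L -> nat -> P), exists2 W : pred nat,
    n <= Q * count W (iota 0 n) &
    exists D : nat -> P, forall tau : nat -> L, exists2 s : seq L, size s = n &
      forall i, i < n -> W i -> nth j s i = tau i /\ (tau i = j -> g s i = D i).
Proof.
set u := #|P|.*2; set M := (u * #|L|.-1).+1.
have P_gt0 : 0 < #|P| by apply/card_gt0P; exists p0.
have u_gt0 : 0 < u by rewrite /u double_gt0.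
have Q_gt0 : 0 < M * u by rewrite muln_gt0.
exists (M * u) => // n g; have [->|n_gt0] := posnP n.
  by exists xpred0 => //; exists (fun=> p0) => tau; exists [::].
have Hlt : u ^ (n %/ (M * u)) * M ^ n <
    2 ^ n * word_count n (labelled j (j, p0) n g).
  rewrite word_count_labelled -expnMn.
  have -> : 2 * (#|P| * #|L|.-1).+1 = M.+1 by rewrite /M /u -muln2; nia.
  set d := n %/ _.
  have Hd : u ^ d * M ^ (M * u * d) <= M.+1 ^ (M * u * d) ?= iff (d == 0).
    rewrite !(expnM _ (M * u)) -expnMn; case: d => [|d]; first exact: leqif_refl.
    have lt_exp : (u * M ^ (M * u)) ^ d.+1 < (M.+1 ^ (M * u)) ^ d.+1.
      by rewrite ltn_exp2r // ltn_exp_succ.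
    by split; [exact: ltnW | rewrite ltn_eqF].
  rewrite [n in M ^ n](divn_eq n (M * u)) [n in _.+1 ^ n](divn_eq n (M * u)) -/d.
  rewrite !expnD mulnA (mulnC d).
  (* Strictness comes from [d] or from the remainder; both vanish only for n = 0. *)
  have [r0|r_gt0] := posnP (n %% (M * u)); last first.
    apply: (@leq_ltn_trans (M.+1 ^ (M * u * d) * M ^ (n %% (M * u)))).
      by rewrite leq_mul2r Hd orbT.
    by rewrite ltn_pmul2l ?expn_gt0 // ltn_exp2r.
  rewrite r0 !muln1 (ltn_leqif Hd); apply: contraL n_gt0 => /eqP d0.
  by rewrite (divn_eq n (M * u)) -/d d0 r0.
have [W dW [D DP]] := shatters_large (j, p0) Hlt.
exists W.
  by rewrite (leq_trans (ltnW (ltn_ceil n Q_gt0))) // mulnC leq_mul2l dW orbT.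
exists (fun i => D i j) => tau; have [s sn [gs sP]] := DP tau.
exists (map fst s); first by rewrite size_map.
move=> i ilt Wi; rewrite (nth_map (j, p0)) ?sn // (sP i) //; split => // tj.
move/allP: gs => /(_ i); rewrite mem_iota ilt => /(_ isT) /=.
by rewrite (sP i) //= tj eqxx => /eqP.
Qed.
Local Open Scope classical_set_scope.

(** * Counting points in windows and blocks *)

Lemma count_iotaD (J : pred nat) n m :
  count J (iota 0 (n + m)) =
  (count J (iota 0 n) + count (fun i => J (n + i)) (iota 0 m))%N.
Proof.
by rewrite iotaD count_cat add0n -[in iota n m](addn0 n) iotaDl count_map.
Qed.

Lemma sum_count_fiber (P : finType) (W : pred nat) (D : nat -> P) (s : seq nat) :
  \sum_p count (fun i => W i && (D i == p)) s = count W s.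
Proof.
under eq_bigr do rewrite -sum1_count big_mkcond.
rewrite exchange_big -[RHS]sum1_count [RHS]big_mkcond /=; apply: eq_bigr => i _.
case: (W i) => /=; last by rewrite big1.
by rewrite -big_mkcond (big_pred1 (D i)) // => p; rewrite eq_sym.
Qed.

Lemma size_le_count_iota (J : pred nat) (s : seq nat) N :
  uniq s -> (forall i, i \in s -> i < N /\ J i) -> size s <= count J (iota 0 N).
Proof.
move=> us sP; rewrite -size_filter; apply: uniq_leq_size => // i /sP[iN Ji].
by rewrite mem_filter Ji mem_iota.
Qed.

Lemma count_blocks_le (J : pred nat) L c a :
  count J (iota 0 (a * L)) <=
  L * count (fun b => c < count J (iota (b * L) L)) (iota 0 a) + a * c.
Proof.
elim: a => [|a IH]; first by rewrite mul0n.
rewrite mulSnr iotaD count_cat add0n -[a.+1]addn1 iotaD count_cat add0n /=.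
have [_|le_c] := ltnP c; last by move: IH le_c; lia.
by have := count_size J (iota (a * L) L); rewrite size_iota; move: IH; lia.
Qed.

(** Otherwise all points would lie within [m] of one of them, hence among 2 m + 1 integers. *)
Lemma count_far_pair (J : pred nat) b L m :
  m.*2.+1 < count J (iota b L) ->
  exists h, exists f, [/\ J h, J (h + f), b <= h, h + f < b + L & m < f].
Proof.
move=> ltc; apply: contrapT => H.
set s := seq.filter J (iota b L).
have us : uniq s by rewrite filter_uniq // iota_uniq.
have [s0|[h hs]] : s = [::] \/ exists h, h \in s.
- by case: s {us} => [|h t]; [left|right; exists h; rewrite mem_head].
- by move: ltc; rewrite -size_filter -/s s0.
have near y : y \in s -> y <= h + m /\ h <= y + m.
  move: hs; rewrite !mem_filter !mem_iota => /andP[Jh bh] /andP[Jy bY].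
  split; rewrite leqNgt; apply/negP => lt; apply: H.
    by exists h, (y - h); rewrite subnKC ?Jh ?Jy; [split=> //|]; lia.
  by exists y, (h - y); rewrite subnKC ?Jh ?Jy; [split=> //|]; lia.
have : size s <= size (iota (h - m) m.*2.+1).
  by apply: uniq_leq_size => // y /near; rewrite mem_iota; lia.
by rewrite size_iota size_filter leqNgt ltc.
Qed.

(** * Positive independence and its two operations *)

Section Independence.
Variables (X : Type) (T : X -> X).

(* Only nonnegative times occur, whether the acting semigroup is [Z] or not. *)
Definition indep (I : Type) (A : I -> set X) (J : pred nat) :=
  forall (sigma : nat -> I) N, exists x,
    forall i, i < N -> J i -> A (sigma i) (iter i T x).

Definition pos_indep (I : Type) (A : I -> set X) :=
  exists2 q, 0 < q & forall n,
    exists2 J, indep A J & n <= q * count J (iota 0 n).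

Lemma indep_shift I (A : I -> set X) J n :
  indep A J -> indep A (fun i => J (n + i)).
Proof.
move=> AJ sigma N.
have [x xP] := AJ (fun i => sigma (i - n)) (n + N).
exists (iter n T x) => i iN Ji.
by have := xP (n + i); rewrite ltn_add2l addKn addnC iterD addnC; exact.
Qed.

(** The map [f] need not be injective: this is how the index set is doubled and how tuples with
    repeated points are handled. *)
Lemma pos_indep_sub I I' (f : I' -> I) (A : I -> set X) (B : I' -> set X) :
  (forall i, A (f i) `<=` B i) -> pos_indep A -> pos_indep B.
Proof.
move=> AB [q q0 qP]; exists q => // n; have [J AJ nJ] := qP n; exists J => //.
move=> sigma N; have [x xP] := AJ (f \o sigma) N.
by exists x => i iN Ji; apply/AB/xP.
Qed.

Lemma pos_indep_nonempty I (A : I -> set X) i : pos_indep A -> A i !=set0.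
Proof.
move=> [q q0 /(_ 1)[J AJ]] /=; case J0 : (J 0) => /=; last by rewrite muln0.
by have [x /(_ 0 isT J0)] := AJ (fun=> i) 1; exists x.
Qed.

(* The bound on one window propagates to all of them by cutting a long window
   into translates of it. *)
Lemma not_pos_indep I (A : I -> set X) q : ~ pos_indep A -> 0 < q ->
  exists C, forall J N, indep A J -> q * count J (iota 0 N) <= N + C.
Proof.
move=> nA q0.
have [n nP] : exists n, forall J, indep A J -> q * count J (iota 0 n) < n.
  apply: contrapT => H; apply: nA; exists q => // n.
  apply: contrapT => H'; apply: H; exists n => J AJ.
  by rewrite ltnNge; apply/negP => le; apply: H'; exists J.
exists (q * n) => J N; elim/ltn_ind: N J => N IH J AJ.
have [ltNn|leNn] := ltnP N n.
  have := count_size J (iota 0 N); rewrite size_iota; nia.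
have n0 : 0 < n by apply: leq_ltn_trans (nP J AJ).
have := IH (N - n) _ _ (indep_shift n AJ).
have := nP J AJ.
rewrite -[in count J (iota 0 N)](subnKC leNn) count_iotaD; nia.
Qed.

(** For each word of indices take a point realising it along an independence set and record the
    piece visited at the occurrences of [j]. By [labelled_sampling] this piece depends on the time
    only, on a positive proportion of times. Sorting these times by piece gives an independence set
    for each replaced family, and they cannot all be sparse. *)
Lemma pos_indep_split (I P : finType) (A : I -> set X) (j : I) (B : P -> set X) :
  (forall x, A j x -> exists p, B p x) -> pos_indep A ->
  exists p, pos_indep (fun i => if i == j then B p else A i).
Proof.
move=> AB Apos.
have [x0 /AB[p0 _]] := pos_indep_nonempty j Apos.
have [Q Q0 QP] := labelled_sampling j p0.
have [q q0 qP] := Apos.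
apply: contrapT => /forallNP nB.
(* With w sampled times, N <= q Q w. Summing the bounds over [p], the factor 2 then leaves |P| N at
   most the sum of the [C p], which is below [N]. *)
have K0 : 0 < (#|P| * q * Q).*2.
  by rewrite double_gt0 !muln_gt0 q0 Q0 !andbT; apply/card_gt0P; exists p0.
have /choice[C CP] := fun p => not_pos_indep (nB p) K0.
set N := (\sum_p C p).+1.
have [J AJ NJ] := qP N.
set pos := seq.filter J (iota 0 N); set n := size pos.
have upos : uniq pos by rewrite filter_uniq // iota_uniq.
have /choice[xg xgP] : forall s : seq I, exists xg : X * (nat -> P),
    forall i, i < n -> let y := iter (nth 0 pos i) T xg.1 in
    A (nth j s i) y /\ (nth j s i = j -> B (xg.2 i) y).
  move=> s; have [x xP] := AJ (fun k => nth j s (index k pos)) N.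
  have Ax i : i < n -> A (nth j s i) (iter (nth 0 pos i) T x).
    move=> ilt; have := xP (nth 0 pos i); rewrite index_uniq //.
    have := mem_nth 0 ilt; rewrite mem_filter mem_iota => /andP[Jk /= ltk].
    exact.
  have /choice[g gP] : forall i, exists p, i < n -> nth j s i = j ->
      B p (iter (nth 0 pos i) T x).
    move=> i; have [ilt|] := boolP (i < n); last by exists p0.
    have [sj|] := eqVneq (nth j s i) j; last by move=> /eqP ?; exists p0.
    by have := Ax i ilt; rewrite sj => /AB[p Bp]; exists p.
  by exists (x, g) => i ilt /=; split; [exact: Ax | exact: gP].
have [W nW [D DP]] := QP n (fun s => (xg s).2).
pose Jp p k := [&& k \in pos, W (index k pos) & D (index k pos) == p].
have BJp p : indep (fun i => if i == j then B p else A i) (Jp p).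
  move=> sigma N'; have [s sn sP] := DP (fun i => sigma (nth 0 pos i)).
  exists (xg s).1 => k _ /and3P[kpos Wk /eqP Dk].
  have kn : index k pos < n by rewrite index_mem.
  have [] := sP _ kn Wk; have [] := xgP s _ kn; rewrite nth_index //.
  move=> Ask Bsk sk; rewrite sk in Ask Bsk *; case: eqP => // skj.
  by move=> /(_ skj); rewrite Dk => <-; apply: Bsk.
have cntJp : \sum_p count (Jp p) (iota 0 N) = count W (iota 0 n).
  rewrite -(sum_count_fiber W D); apply: eq_bigr => p _.
  transitivity (count (fun k => W (index k pos) && (D (index k pos) == p)) pos).
    rewrite /pos count_filter; apply: eq_in_count => k kN.
    by rewrite /Jp /pos mem_filter kN andbT andbC.
  have -> a : count a pos = count (a \o nth 0 pos) (iota 0 n).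
    by rewrite -[in LHS](mkseq_nth 0 pos) count_map.
  apply: eq_in_count => i.
  by rewrite mem_iota => /andP[_ ilt] /=; rewrite index_uniq.
have : \sum_p (#|P| * q * Q).*2 * count (Jp p) (iota 0 N) <= \sum_p (N + C p).
  by apply: leq_sum => p _; apply: CP.
have -> : \sum_p (N + C p) = #|P| * N + \sum_p C p.
  by rewrite big_split sum_nat_const.
rewrite -big_distrr /= cntJp.
move: NJ; rewrite -size_filter -/pos -/n.
have P0 : 0 < #|P| by apply/card_gt0P; exists p0.
have := leq_mul (leqnn (#|P| * q)) nW.
set w := count W _; set c := \sum_p _ => h1 h2 h3.
have h4 := leq_mul (leqnn #|P|) h2.
have h5 : N <= #|P| * N by rewrite leq_pmull.
have : c < N by [].
move: h1 h3 h4 h5; move: #|P|.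
lia.
Qed.

(* Blocks of length [L] containing many points of an independence set contain
   two of them at distance [> m]; the most popular distance is the desired one. *)
Lemma pos_indep_return (I : Type) (A : I -> set X) (gamma : I -> I) m :
  pos_indep A ->
  exists2 f, m < f &
    pos_indep (fun i => A i `&` (iter f T @^-1` A (gamma i))).
Proof.
move=> [q q0 qP]; apply: contrapT => H.
(* Blocks with at most [c] points carry at most half of the guaranteed density 1 / q, so at least a
   proportion 1 / L of the blocks is good. *)
pose c := m.*2.+1; pose L := (q * c).*2.
have L0 : 0 < L by rewrite double_gt0 muln_gt0 q0.
have K0 : 0 < (L * L * L).*2 by rewrite double_gt0 !muln_gt0 L0.
pose Af f i := A i `&` (iter f T @^-1` A (gamma i)).
have /choice[C CP] : forall f : 'I_L, exists C, m < f -> forall J N,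
    indep (Af f) J -> (L * L * L).*2 * count J (iota 0 N) <= N + C.
  move=> f; have [mf|nmf] := boolP (m < f); last by exists 0.
  have [|C CP] := @not_pos_indep I (Af f) _ _ K0; last by exists C.
  by move=> Af_pos; apply: H; exists f.
set a := (\sum_f C f).+1.
have [J AJ aJ] := qP (a * L).
pose good b := c < count J (iota (b * L) L).
have /choice[hf hfP] : forall b, exists hf : nat * 'I_L, good b ->
    let: (h, f) := hf in
    [/\ J h, J (h + f), b * L <= h, h + f < b * L + L & m < f].
  move=> b; have [gb|] := boolP (good b); last by exists (0, Ordinal L0).
  have [h [f [Jh Jhf bh hfb mf]]] := count_far_pair gb.
  have fL : f < L by lia.
  by exists (h, Ordinal fL).
pose h b := (hf b).1; pose d b := (hf b).2.
have {}hfP b : good b ->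
    [/\ J (h b), J (h b + d b), b * L <= h b, h b + d b < b * L + L & m < d b].
  by move=> /hfP; rewrite /h /d; case: (hf b).
have blockP b k : b * L <= k -> k < b * L + L -> k %/ L = b.
  move=> bk kb; rewrite -(subnK bk) addnC divnMDl // divn_small ?addn0 //.
  by rewrite ltn_subLR.
pose Jf f := [pred k | [&& good (k %/ L), h (k %/ L) == k & d (k %/ L) == f]].
have AJf (f : 'I_L) : indep (Af f) (Jf f).
  (* The first point of a chosen pair keeps its index under [sigma]; the second gets the image of
     that index under [gamma]. *)
  move=> sigma N; pose sigma' k :=
    if h (k %/ L) == k then sigma k else gamma (sigma (h (k %/ L))).
  have [x xP] := AJ sigma' (N + L).
  exists x => k kN /and3P[]; set b := k %/ L => gb /eqP hk /eqP df.
  have [Jh Jhf bh hfb mf] := hfP b gb; rewrite hk df in Jh Jhf bh hfb mf.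
  split.
    have := xP k; rewrite /sigma' -/b hk eqxx; apply => //.
    exact: ltn_addr.
  have := xP (k + f); rewrite /sigma' (blockP b) ?(leq_trans bh) ?leq_addr //.
  have -> : (h b == k + f) = false by rewrite hk; apply/eqP; lia.
  rewrite hk /preimage /= -iterD [(f + k)%N]addnC; apply => //.
  by have := ltn_ord f; lia.
have cntJf (f : 'I_L) : count (fun b => good b && (d b == f)) (iota 0 a) <=
    count (Jf f) (iota 0 (a * L)).
  rewrite -size_filter -(size_map h); set s := seq.filter _ _.
  have sP b : b \in s -> [/\ good b, d b = f, b < a & h b %/ L = b].
    rewrite mem_filter mem_iota => /andP[/andP[gb /eqP df] /= ba].
    have [_ _ bh hfb _] := hfP b gb.
    by split=> //; apply: blockP => //; apply: leq_ltn_trans hfb; exact: leq_addr.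
  apply: size_le_count_iota.
    rewrite map_inj_in_uniq ?filter_uniq ?iota_uniq //.
    by move=> b b' /sP[_ _ _ hb] /sP[_ _ _ hb'] e; rewrite -hb -hb' e.
  move=> k /mapP[b /sP[gb df ba hb] ->]; rewrite /= hb gb df !eqxx; split=> //.
  have [_ _ _ hfb _] := hfP b gb.
  have : b.+1 * L <= a * L by rewrite leq_mul2r ba orbT.
  by rewrite mulSnr; lia.
have cnt0 (f : 'I_L) : ~~ (m < f) ->
    count (fun b => good b && (d b == f)) (iota 0 a) = 0.
  move=> nmf; apply/eqP; rewrite -leqn0 leqNgt -has_count; apply/hasPn => b _.
  by apply: contra nmf => /andP[/hfP[_ _ _ _ mf] /eqP <-].
have : \sum_f (L * L * L).*2 * count (fun b => good b && (d b == f)) (iota 0 a)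
    <= \sum_(f < L) (a * L + C f).
  apply: leq_sum => f _; have [mf|/cnt0 ->] := boolP (m < f); last first.
    by rewrite muln0.
  by rewrite (leq_trans _ (CP f mf _ _ (AJf f))) // leq_mul2l cntJf orbT.
have -> : \sum_(f < L) (a * L + C f) = L * (a * L) + \sum_f C f.
  by rewrite big_split sum_nat_const card_ord.
rewrite -big_distrr (sum_count_fiber good d).
have := count_blocks_le J L c a; rewrite -/good.
set G := count good _ => cJ.
have aLG : a <= L * G.
  have := leq_trans aJ (leq_mul (leqnn q) cJ); rewrite {1}/L => h1.
  have : q * (a * c) <= q * (L * G).
    by move: h1; move: (L * G) => LG; lia.
  by rewrite leq_pmul2l //; apply: leq_trans; rewrite leq_pmulr.
have CA : \sum_f C f < a by [].
have := leq_mul (leqnn (L * L)) aLG; move: CA; move: (\sum_f C f) => c'.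
have : a <= L * L * a by rewrite leq_pmull // muln_gt0 L0.
by rewrite -muln2 /=; clearbody L a G; lia.
Qed.

End Independence.

Import Order.TTheory GRing.Theory Num.Theory.
Import numFieldNormedType.Exports.
Local Open Scope ring_scope.

(** * Positive independence and the existence of densities *)

Section Density.
Variables (R : realType) (X : Type) (T : X -> X) (I : Type) (A : I -> set X).

Local Notation cnt J n := ((count J (iota 0 n))%:R : R).

Let cnt_le (J : pred nat) n : cnt J n <= n%:R.
Proof. by rewrite ler_nat -{2}(size_iota 0 n) count_size. Qed.

(** Failure would bound every count by (N + C) / q; with 2 / q at most [d] this contradicts density
    [d] on a long window. *)
Lemma pos_indep_of_density (d : R) : 0 < d ->
  (forall n, exists2 N, (n <= N)%N & exists2 J, indep T A J & d * N%:R <= cnt J N) ->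
  pos_indep T A.
Proof.
move=> d0 dP; apply: contrapT => nA.
have [q q0 qd] : exists2 q, (0 < q)%N & 2 <= q%:R * d.
  exists (Num.truncn (2 / d)).+1 => //.
  by rewrite -ler_pdivrMr // ltW // truncnS_gt.
have [C CP] := not_pos_indep nA q0.
have [N CN [J AJ dJ]] := dP C.+1.
have := CP J N AJ; rewrite -(ler_nat R) natrM natrD => le1.
have : q%:R * (d * N%:R) <= q%:R * cnt J N by rewrite ler_wpM2l.
rewrite mulrA => le2.
have : 2 * N%:R <= q%:R * d * N%:R by rewrite ler_wpM2r.
have : C%:R < N%:R :> R by rewrite ltr_nat.
lra.
Qed.

(** Remove a sparse initial window, shift, and repeat; the incomplete last window causes the
    additive error. *)
Lemma count_le_windows (c : R) K :
  (forall J, indep T A J ->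
    exists2 n, (0 < n <= K)%N & cnt J n <= c * n%:R) ->
  forall J N, indep T A J -> cnt J N <= c * N%:R + (1 + `|c|) * K%:R.
Proof.
move=> H J N; elim/ltn_ind: N J => N IH J AJ.
have [n /andP[n0 nK] cn] := H J AJ.
have [ltNn|leNn] := ltnP N n.
  have NK : N%:R <= K%:R :> R by rewrite ler_nat (leq_trans (ltnW ltNn)).
  have := cnt_le J N.
  have : - c * N%:R <= `|c| * N%:R by rewrite ler_wpM2r // -normrN ler_norm.
  have : `|c| * N%:R <= `|c| * K%:R by rewrite ler_wpM2l.
  lra.
have ltN : (N - n < N)%N by lia.
have := IH _ ltN _ (indep_shift n AJ).
rewrite -[in count J (iota 0 N)](subnKC leNn) count_iotaD natrD.
rewrite -[in c * N%:R](subnKC leNn) natrD mulrDr => le1.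
by rewrite -addrA lerD.
Qed.

(* [D] is the supremum of the densities attained on all windows [0, n). An
   ultrafilter limit of independence sets that are [D]-dense on longer and longer
   initial windows is [D]-dense on all of them, and cannot be denser. *)
Lemma pos_indep_density : pos_indep T A ->
  exists2 J, indep T A J &
  exists2 d : R, 0 < d & (fun n => cnt J n / n%:R) @ \oo --> d.
Proof.
move=> [q q0 qP].
pose S := [set c : R | forall n, exists2 J, indep T A J & c * n%:R <= cnt J n].
have Sq : S q%:R^-1.
  move=> n; have [J AJ nJ] := qP n; exists J => //.
  by rewrite mulrC ler_pdivrMr ?ltr0n // mulrC -natrM ler_nat.
have S1 : ubound S 1.
  move=> c /(_ 1%N)[J _]; rewrite mulr1 => /le_trans; apply; exact: cnt_le.
have supS : has_sup S by split; [exists q%:R^-1 | exists 1].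
set D := sup S.
have D0 : 0 < D.
  apply: (@lt_le_trans _ _ q%:R^-1); first by rewrite invr_gt0 ltr0n.
  by apply: ub_le_sup => //; exists 1.
have SD (e : R) : 0 < e -> S (D - e).
  move=> e0; have [c Sc cD] := sup_adherent e0 supS.
  move=> n; have [J AJ cJ] := Sc n; exists J => //.
  by apply: le_trans cJ; rewrite ler_wpM2r // ltW.
have upper (e : R) : 0 < e -> exists C : R, forall J N, indep T A J ->
    cnt J N <= (D + e) * N%:R + C.
  move=> e0; have nS : ~ S (D + e).
    by move=> /(ub_le_sup (ex_intro _ 1 S1)); rewrite -/D; lra.
  have [n nP] : exists n, forall J, indep T A J -> cnt J n < (D + e) * n%:R.
    apply: contrapT => H; apply: nS => n; apply: contrapT => H'.
    apply: H; exists n => J AJ; rewrite ltNge; apply/negP => le.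
    by apply: H'; exists J.
  exists ((1 + `|D + e|) * n%:R); apply: count_le_windows => J AJ; exists n.
    by rewrite leqnn andbT lt0n; apply/eqP => n0; have := nP J AJ; rewrite n0 mulr0 ltxx.
  exact/ltW/nP.
have lower K : exists J, indep T A J /\
    forall n, (n <= K)%N -> (D - K.+1%:R^-1) * n%:R <= cnt J n.
  set e := K.+1%:R^-1.
  have e0 : 0 < e by rewrite invr_gt0 ltr0n.
  (* Otherwise every independence set starts with a sparse window of length at most [K], and cutting
     these off repeatedly keeps long windows below density D - e / 2, against [SD]. *)
  apply: contrapT => H.
  have cover J N : indep T A J ->
      cnt J N <= (D - e) * N%:R + (1 + `|D - e|) * K%:R.
    apply: count_le_windows => {N}J AJ; apply: contrapT => H'.
    apply: H; exists J; split=> // n nK; rewrite leNgt; apply/negP => lt.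
    apply: H'; exists n; last exact: ltW.
    by rewrite nK andbT lt0n; apply/eqP => n0; move: lt; rewrite n0 mulr0 ltxx.
  set C := (1 + _) * _ in cover.
  pose N := (Num.truncn (C / (e / 2))).+1.
  have e20 : 0 < e / 2 by rewrite divr_gt0.
  have [J AJ DJ] := SD (e / 2) e20 N.
  have := cover J N AJ.
  have : C < N%:R * (e / 2).
    by rewrite -ltr_pdivrMr ?divr_gt0 // truncnS_gt.
  lra.
have [J_ J_P] := choice lower.
have [U [Uultra Uoo]] := ultraFilterLemma (eventually_filter : ProperFilter \oo).
pose J i := `[< U [set K | J_ K i] >].
(* [U] decides the membership of each integer, so for [U]-many [K] the set [J_ K] agrees with the
   limit [J] below [n]. *)
have agree n : U [set K | forall i, (i < n)%N -> J_ K i = J i].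
  elim: n => [|n IH]; first by apply: filterS filterT.
  have UJ : U [set K | J_ K n = J n].
    rewrite /J; case: asboolP => [|nU]; first by apply: filterS => K.
    have [//|] := in_ultra_setVsetC [set K | J_ K n] Uultra.
    by apply: filterS => K /= /negP/negbTE.
  apply: filterS2 IH UJ => K /= IH UJ i; rewrite ltnS leq_eqVlt.
  by case/predU1P => [->//|]; apply: IH.
have agree_ex n K0 : exists2 K, (K0 <= K)%N &
    forall i, (i < n)%N -> J_ K i = J i.
  have UK : U [set K | (K0 <= K)%N] by apply: Uoo; exists K0.
  by have [K [KK0 KP]] := filter_ex (filterI UK (agree n)); exists K.
have AJ : indep T A J.
  move=> sigma N; have [K _ KP] := agree_ex N 0%N.
  have [x xP] := (J_P K).1 sigma N.
  by exists x => i iN; rewrite -(KP i iN); exact: xP.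
exists J => //; exists D => //.
have DJ n : D * n%:R <= cnt J n.
  apply/ler_addgt0Pr => e e0.
  have [K KK0 KP] := agree_ex n (maxn n (Num.truncn (n%:R / e))).
  move: KK0; rewrite geq_max => /andP[nK eK].
  have -> : cnt J n = cnt (J_ K) n.
    congr (_%:R); apply: eq_in_count => i; rewrite mem_iota => /andP[_ ilt].
    by rewrite (KP i).
  have := (J_P K).2 n nK; rewrite mulrBl.
  have : K.+1%:R^-1 * n%:R <= e.
    rewrite mulrC ler_pdivrMr ?ltr0n // mulrC -ler_pdivrMr //.
    by rewrite ltW // (lt_le_trans (truncnS_gt _)) // ler_nat.
  by move: (K.+1%:R^-1 * _) => z; lra.
apply/cvgrPdist_le => e e0.
have e20 : 0 < e / 2 by rewrite divr_gt0.
have [C CP] := upper (e / 2) e20.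
exists (Num.truncn (C / (e / 2))).+1 => // n /= ltn.
have n0 : 0 < n%:R :> R by rewrite ltr0n (leq_ltn_trans _ ltn).
have : C <= n%:R * (e / 2).
  rewrite -ler_pdivrMr ?divr_gt0 // ltW // (lt_le_trans (truncnS_gt _)) //.
  by rewrite ler_nat.
have := CP J n AJ; have := DJ n => lb ub hC.
have lb' : D <= cnt J n / n%:R by rewrite ler_pdivlMr.
have ub' : cnt J n / n%:R <= D + e by rewrite ler_pdivrMr //; lra.
by rewrite distrC ger0_norm ?subr_ge0 // lerBlDl.
Qed.

End Density.

(** * Positive independence versus independence sets of positive density *)

Section IndependenceSets.
Variables (R : realType) (X : Type) (T Tinv : X -> X) (isZ : bool).

Lemma count_iotaE (J : pred nat) n : count J (iota 0 n) = (\sum_(i < n) J i)%N.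
Proof.
rewrite -sum1_count big_mkcond -(big_mkord xpredT (fun i => J i : nat)).
by rewrite /index_iota subn0; apply: eq_bigr => i _; case: (J i).
Qed.

Lemma finite_set_int_bound (I : set int) :
  finite_set I -> exists N, forall z, I z -> (`|z| < N)%N.
Proof.
move=> /finite_seqP[s ->]; exists (\max_(z <- s) `|z|).+1 => z /= zs.
by rewrite ltnS leq_bigmax_seq.
Qed.

Lemma pos_indep_positive_density l (A : 'I_l -> set X) : pos_indep T A ->
  exists J, independence_set T Tinv isZ A J /\ positive_density R isZ J.
Proof.
move=> /(pos_indep_density R)[J AJ [d d0 dP]].
pose JZ := [set z | exists2 i, z = Posz i & J i].
have JZE i : (i%:Z \in JZ) = J i.
  by apply/idP/idP => [|Ji]; rewrite inE; [case=> k [->] | exists i].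
exists JZ; split; first split.
- by case: isZ => // z [i -> _].
- move=> I sigma finI _ IJ; have [N NP] := finite_set_int_bound finI.
  have [x xP] := AJ (fun i => sigma i%:Z) N.
  exists x => z Iz; have [i zi Ji] := IJ z Iz.
  by rewrite zi; apply: xP => //; have := NP z Iz; rewrite zi.
rewrite /positive_density; case: isZ; last first.
  split; first by move=> z [i -> _].
  exists d; first by rewrite gt_eqF.
  rewrite (_ : (fun _ => _) =
      (fun n => (count J (iota 0 n.+1))%:R / n.+1%:R)); last first.
    apply/funext => n; rewrite /count_pos count_iotaE.
    by under eq_bigr do rewrite JZE.
  by have := dP; rewrite -cvg_shiftS.
exists (d / 2); first by rewrite gt_eqF // divr_gt0.
have count_symE n : count_sym JZ n = count J (iota 0 n.+1).
  rewrite count_iotaE /count_sym -addnn -addnS big_split_ord /=.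
  rewrite big1 ?add0n => [|i _].
    by apply: eq_bigr => i _; rewrite PoszD addrC addKr JZE.
  apply/eqP; rewrite eqb0; apply/negP; rewrite inE => -[k].
  by have := ltn_ord i; lia.
(* The factor is (n + 1) / (2 n + 1), the change from the one-sided to the symmetric window; it
   halves the limit. *)
have : (fun n => (count J (iota 0 n.+1))%:R / n.+1%:R *
    (2^-1 * (1 + (n.*2).+1%:R^-1)) : R) @ \oo --> d * (2^-1 * (1 + 0)).
  apply: cvgM; first by have := dP; rewrite -cvg_shiftS.
  apply: cvgM; first exact: cvg_cst.
  apply: cvgD; first exact: cvg_cst.
  apply/cvgrPdist_le => e e0; exists (Num.truncn e^-1) => // n /= ltn.
  rewrite sub0r normrN ger0_norm ?invr_ge0 // -[e]invrK lef_pV2 ?posrE ?invr_gt0 //.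
  rewrite ltW // (lt_le_trans (truncnS_gt _)) // ler_nat ltnS (leq_trans ltn) //.
  by rewrite -addnn leq_addr.
rewrite addr0 mulr1 => dP2.
rewrite (_ : (fun _ => _) = (fun n => (count J (iota 0 n.+1))%:R / n.+1%:R *
    (2^-1 * (1 + (n.*2).+1%:R^-1)))) //; apply/funext => n.
rewrite count_symE -!mulrA; congr (_ * _).
have -> : n.*2.+1%:R = 2 * n%:R + 1 :> R by rewrite -natr1 -mul2n natrM.
have : (0 : R) <= n%:R by []; rewrite -(natr1 n); move: (n%:R : R) => z z0.
by field; apply/andP; split; lra.
Qed.

Lemma actZ_sub (i a : nat) z : cancel Tinv T ->
  actZ T Tinv (i%:Z - a%:Z) z = iter i T (iter a Tinv z).
Proof.
move=> TinvK.
have iterK n y : iter n T (iter n Tinv y) = y.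
  by elim: n y => // n IH y; rewrite iterSr iterS TinvK.
have [ai|ia] := leqP a i.
  by rewrite subzn //= -[in RHS](subnK ai) iterD iterK.
have -> : i%:Z - a%:Z = Negz (a - i.+1) by lia.
by rewrite -[in RHS](subnKC (ltnW ia)) iterD iterK /= -iterS subnSK.
Qed.

(** Over the integers, the window [-a, a] moves to [0, 2 a] when a point is replaced by its image
    under the [a]-th iterate of [Tinv]. *)
Lemma positive_density_pos_indep l (A : 'I_l -> set X) (J : set int) (x0 : X) :
  (isZ -> cancel Tinv T) ->
  independence_set T Tinv isZ A J -> positive_density R isZ J -> pos_indep T A.
Proof.
move=> TK [JG AJ] Jd.
have AJa (a : nat) : isZ || (a == 0%N) ->
    indep T A (fun i => (i%:Z - a%:Z) \in J).
  move=> aP sigma N.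
  pose I : set int := [set z | exists2 i, (i < N)%N & z = i%:Z - a%:Z /\ J z].
  have [I0|I0] := pselect (I !=set0); last first.
    exists x0 => i iN; rewrite inE => Ji; exfalso; apply: I0.
    by exists (i%:Z - a%:Z), i.
  have [||y yP] := AJ I (fun z => sigma (absz (z + a%:Z))) _ I0.
  - apply: (@sub_finite_set _ _ ((fun i : nat => i%:Z - a%:Z) @` `I_N)).
      by move=> z [i iN [-> _]]; exists i.
    exact/finite_image/finite_II.
  - by move=> z [i _ [_]].
  have actE i : actZ T Tinv (i%:Z - a%:Z) y = iter i T (iter a Tinv y).
    case: isZ TK aP => [/(_ isT) KT _|_ /eqP ->]; first exact: actZ_sub.
    by rewrite subr0.
  exists (iter a Tinv y) => i iN; rewrite inE => Ji.
  have := yP (i%:Z - a%:Z); rewrite /preimage /= actE subrK absz_nat; apply.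
  by exists i.
have half (u : nat -> R) (d : R) : d != 0 -> (forall n, 0 <= u n) -> u @ \oo --> d ->
    0 < d / 2 /\ \forall n \near \oo, d / 2 <= u n.
  move=> d0 u0 ud.
  have dpos : 0 < d.
    rewrite lt_def d0 -(cvg_lim (@Rhausdorff R) ud) limr_ge //.
      by apply: cvgP ud.
    exact: nearW.
  split; first by rewrite divr_gt0.
  move/cvgrPdist_le : ud => /(_ (d / 2)) [|N _ NP]; first by rewrite divr_gt0.
  by exists N => // n /NP; rewrite ler_norml => /andP[]; lra.
move: Jd; rewrite /positive_density; case: isZ AJa => AJa.
  move=> [d d0 dP]; have [|d2 [N _ NP]] := half _ _ d0 _ dP.
    by move=> n; rewrite divr_ge0.
  apply: (pos_indep_of_density d2) => n.
  exists ((maxn n N).*2).+1.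
    by rewrite -addnn ltnW // ltnS (leq_trans (leq_maxl n N)) // leq_addr.
  exists (fun i => (i%:Z - (maxn n N)%:Z) \in J); first exact: AJa.
  rewrite count_iotaE -ler_pdivlMr ?ltr0n //.
  exact: NP (maxn n N) (leq_maxr _ _).
move=> [_ [d d0 dP]]; have [|d2 [N _ NP]] := half _ _ d0 _ dP.
  by move=> n; rewrite divr_ge0.
apply: (pos_indep_of_density d2) => n.
exists (maxn n N).+1; first by rewrite ltnW // ltnS leq_maxl.
exists (fun i => (i%:Z - 0%N%:Z) \in J); first exact: AJa.
rewrite count_iotaE -ler_pdivlMr ?ltr0n //.
under eq_bigr do rewrite subr0.
exact: NP (maxn n N) (leq_maxr _ _).
Qed.

End IndependenceSets.

(** * Refining closed families in a compact metric space *)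

Section CompatibleMetric.
Variables (R : realType) (X : topologicalType) (rho : X -> X -> R).
Hypothesis rhoP : is_compatible_metric rho.

Lemma cmetric_refl x : rho x x = 0.
Proof. by case: rhoP => h _ _ _; apply/h. Qed.

Lemma cmetric_sym x y : rho x y = rho y x.
Proof. by case: rhoP. Qed.

Lemma cmetric_triangle x y z : rho x z <= rho x y + rho y z.
Proof. by case: rhoP. Qed.

Lemma cmetric_ge0 x y : 0 <= rho x y.
Proof.
have := cmetric_triangle x y x; rewrite cmetric_refl (cmetric_sym y x); lra.
Qed.

Lemma cmetric_gt0 x y : x <> y -> 0 < rho x y.
Proof.
move=> xy; rewrite lt_def cmetric_ge0 andbT; apply/eqP => /[dup] e.
by case: rhoP => h _ _ _ /h.
Qed.

Lemma nbhs_metricP x U :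
  nbhs x U <-> exists2 e : R, 0 < e & [set y | rho x y < e] `<=` U.
Proof. by case: rhoP. Qed.

Lemma cmetric_hausdorff : hausdorff_space X.
Proof.
move=> p q pq; apply: contrapT => /cmetric_gt0 r0.
have r20 : 0 < rho p q / 2 by rewrite divr_gt0.
have [||z [/= pz qz]] := pq [set z | rho p z < rho p q / 2]
    [set z | rho q z < rho p q / 2].
- by apply/nbhs_metricP; exists (rho p q / 2).
- by apply/nbhs_metricP; exists (rho p q / 2).
have := cmetric_triangle p z q; rewrite (cmetric_sym z q); lra.
Qed.

Lemma closed_metric_ball x r : closed [set y | rho x y <= r].
Proof.
move=> y /= cly; apply/ler_addgt0Pr => e e0.
have [|z [/= xz yz]] := cly [set z | rho y z < e].
  by apply/nbhs_metricP; exists e.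
by have := cmetric_triangle x z y; rewrite (cmetric_sym z y); lra.
Qed.

Lemma closed_iter_preimage (T : X -> X) n (B : set X) : continuous T -> closed B ->
  closed (iter n T @^-1` B).
Proof.
move=> Tc clB; have Tnc : continuous (iter n T).
  elim: n => [|n IH] x; first exact: cvg_id.
  exact: (continuous_comp (IH x) (Tc (iter n T x))).
exact: (proj1 (continuous_closedP _) Tnc).
Qed.

(** If no finite set of centres sufficed, the sets [far s] would generate a proper filter, but a
    cluster point [p] of it is excluded by [far [:: p]]. *)
Lemma compact_finite_cover (e : R) : compact [set: X] -> 0 < e ->
  exists (P : finType) (D : P -> set X), [/\ forall p, closed (D p),
    forall p x y, D p x -> D p y -> rho x y <= e & forall x, exists p, D p x].
Proof.
move=> Xc e0.
pose far (s : seq X) := [set y | forall c, c \in s -> e / 2 <= rho c y].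
have [s sX] : exists s, far s = set0.
  apply: contrapT => /forallNP far0.
  have farF : ProperFilter (filter_from [set: seq X] far).
    apply: filter_from_proper => [|s _]; last exact/set0P/eqP/far0.
    apply: filter_from_filter; first by exists [::].
    move=> s t _ _; exists (s ++ t) => // y yP.
    by split=> c cs; apply: yP; rewrite mem_cat cs ?orbT.
  have [p [_ clp]] := Xc _ farF (filterT (F := filter_from _ far)).
  have [||y [/= yp py]] := clp (far [:: p]) [set y | rho p y < e / 2].
  - by exists [:: p].
  - by apply/nbhs_metricP; exists (e / 2) => //; rewrite divr_gt0.
  by move: (yp p); rewrite mem_head leNgt py => /(_ isT).
exists (seq_sub s), (fun c => [set y | rho (ssval c) y <= e / 2]); split.
- by move=> p; exact: closed_metric_ball.
- move=> p x y /= px py; have := cmetric_triangle x (ssval p) y.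
  by rewrite (cmetric_sym x (ssval p)); lra.
move=> x; apply: contrapT => /forallNP xP.
suff : far s x by rewrite sX.
by move=> c cs; rewrite leNgt; apply/negP => /ltW cx; apply: (xP (SeqSub cs)).
Qed.

Variable T : X -> X.
Hypotheses (Xcompact : compact [set: X]) (Tcont : continuous T).

(** Maps are treated one at a time: later families shrink earlier ones, so returns already obtained
    persist. *)
Lemma pos_indep_returns (I : finType) (A : I -> set X) m (s : seq (I -> I)) :
  (forall i, closed (A i)) -> pos_indep T A ->
  exists B : I -> set X, [/\ forall i, closed (B i), pos_indep T B,
    forall i, B i `<=` A i &
    forall l, (l < size s)%N ->
      exists2 h, (m < h)%N & forall i x, B i x -> A (nth id s l i) (iter h T x)].
Proof.
elim: s A => [|g s IH] A clA posA; first by exists A; split=> // i x.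
have [h mh posB] := pos_indep_return g m posA.
have [|B [clB {}posB subB retB]] := IH _ _ posB.
  move=> i; apply: closedI => //; exact: closed_iter_preimage.
exists B; split => //; first by move=> i x /subB[].
move=> [_|l ls]; first by exists h => // i x /subB[].
by have [h' mh' retB'] := retB l ls; exists h' => // i x /retB'[].
Qed.

Lemma pos_indep_shrink (I : finType) (A : I -> set X) (e : R) (s : seq I) :
  0 < e -> (forall i, closed (A i)) -> pos_indep T A ->
  exists B : I -> set X, [/\ forall i, closed (B i), pos_indep T B,
    forall i, B i `<=` A i &
    forall i x y, i \in s -> B i x -> B i y -> rho x y <= e].
Proof.
move=> e0; have [P [D [clD diamD covD]]] := compact_finite_cover Xcompact e0.
elim: s A => [|j s IH] A clA posA; first by exists A; split=> // i x.
have [|p posB] := pos_indep_split (B := fun p => A j `&` D p) _ posA (j := j).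
  by move=> x Ax; have [p Dx] := covD x; exists p.
have [|B [clB {}posB subB diamB]] := IH _ _ posB.
  by move=> i; case: eqP => // _; apply: closedI.
exists B; split => // [i x /subB|i x y].
  by case: eqP => // -> [].
rewrite inE => /predU1P[->|]; last exact: diamB.
by move=> /subB + /subB; rewrite eqxx => -[_ Dx] [_ Dy]; apply: diamD Dx Dy.
Qed.

Lemma pos_indep_refine (I : finType) (A : I -> set X) (e : R) m :
  0 < e -> (forall i, closed (A i)) -> pos_indep T A ->
  exists B : I -> set X, [/\ forall i, closed (B i), pos_indep T B,
    forall i, B i `<=` A i,
    forall i x y, B i x -> B i y -> rho x y <= e &
    forall g : I -> I,
      exists2 h, (m < h)%N & forall i x, B i x -> A (g i) (iter h T x)].
Proof.
move=> e0 clA posA.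
pose s := map (fun g : {ffun I -> I} => (g : I -> I)) (enum {: {ffun I -> I}}).
have [B [clB posB subB retB]] := pos_indep_returns m s clA posA.
have [C [clC posC subC diamC]] := pos_indep_shrink (enum I) e0 clB posB.
exists C; split => // [i x /subC/subB//|i x y|g].
  by apply: diamC; rewrite mem_enum.
pose f := finfun g.
have fs : (index f (enum {: {ffun I -> I}}) < size s)%N.
  by rewrite size_map index_mem mem_enum.
have [h mh hP] := retB _ fs; exists h => // i x /subC /hP.
rewrite (nth_map f) ?index_mem ?mem_enum // nth_index ?mem_enum //.
by rewrite ffunE.
Qed.

End CompatibleMetric.

(** * Finite prefixes and Cantor sets *)

(* The most recent bit comes first, so that truncation is [behead]. *)
Fixpoint prefix_rev (c : cantor_space) n : n.-tuple bool :=
  if n is n'.+1 then cons_tuple (c n') (prefix_rev c n') else [tuple].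

Definition parent k n (i : 'I_k * n.+1.-tuple bool) : 'I_k * n.-tuple bool :=
  (i.1, behead_tuple i.2).

Lemma parent_prefix k (j : 'I_k) c n :
  parent (j, prefix_rev c n.+1) = (j, prefix_rev c n).
Proof. by congr pair; apply: val_inj. Qed.

Lemma prefix_rev_inj c c' : (forall n, prefix_rev c n = prefix_rev c' n) -> c = c'.
Proof. by move=> cc'; apply/funext => n; have [] := cc' n.+1. Qed.

Lemma prefix_rev_mono c c' m n : (m <= n)%N ->
  prefix_rev c n = prefix_rev c' n -> prefix_rev c m = prefix_rev c' m.
Proof.
elim: n => [|n IH]; first by rewrite leqn0 => /eqP ->.
rewrite leq_eqVlt => /predU1P[->//|mn] [_ e]; apply: IH => //.
exact: val_inj.
Qed.

Lemma nbhs_prefix_rev c n : nbhs c [set c' | prefix_rev c' n = prefix_rev c n].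
Proof.
elim: n => [|n IH]; first by apply: filterS filterT.
have cn : nbhs c [set c' : cantor_space | c' n = c n].
  exact: (@proj_continuous nat (fun=> bool) n c _ (discrete_set1 (c n))).
by apply: filterS2 cn IH => c' /= -> ->.
Qed.

(** A continuous map from a compact space to a Hausdorff space is closed, so the inverse is
    continuous on the range; [g] extends it by an arbitrary value. *)
Lemma is_cantor_set_range (X : topologicalType) (f : cantor_space -> X) :
  hausdorff_space X -> continuous f -> injective f ->
  is_cantor_set (range f).
Proof.
move=> hX fc finj; exists f; split => //.
have /choice[g gP] : forall x, exists c, forall c', f c' = x -> c = c'.
  move=> x; have [[c _ <-]|nx] := pselect (range f x).
    by exists c => c' /finj.
  by exists point => c' fx; exfalso; apply: nx; exists c'.
have fK c : g (f c) = c by apply: gP.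
exists g; split => //; apply/subspace_continuousP => _ [c _ <-] W.
move=> gW; have {}gW : nbhs c W by rewrite -[c in nbhs c _]fK.
have [V [oV Vc] VW] : exists2 V, open_nbhs c V & V `<=` W by move: gW; rewrite nbhsE.
have clfV : closed (f @` (~` V)).
  apply: compact_closed => //; apply: continuous_compact.
    exact: continuous_subspaceT.
  apply: (subclosed_compact _ cantor_space_compact) => //.
  exact: open_closedC.
have nfVc : nbhs (f c) (~` (f @` (~` V))).
  apply: open_nbhs_nbhs; split; first exact: closed_openC.
  by move=> [c' nVc' /finj e]; apply: nVc'; rewrite e.
change (nbhs (f c) [set y | range f y -> W (g y)]).
apply: filterS nfVc => y nfV [c' _ fc'].
apply: VW; rewrite -fc' fK; apply: contrapT => nVc'.
by apply: nfV; exists c'.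
Qed.

(** * The tree of closed sets and its branches *)

Section Tower.
Variables (R : realType) (X : topologicalType) (rho : X -> X -> R).
Variables (T : X -> X) (k : nat).
Hypotheses (rhoP : is_compatible_metric rho) (Xcompact : compact [set: X]).

(** Each step refines the previous family copied along [parent]. Returns reach the sets of that
    copy, hence land in the parent of [g i]. *)
Record tower (F : forall n, 'I_k * n.-tuple bool -> set X) : Prop := Tower {
  tower_closed : forall n i, closed (F n i);
  tower_pos : forall n, pos_indep T (F n);
  tower_parent : forall n i, F n.+1 i `<=` F n (parent i);
  tower_diam : forall n i x y, F n.+1 i x -> F n.+1 i y -> rho x y <= n.+1%:R^-1;
  tower_return : forall n (g : 'I_k * n.+1.-tuple bool -> 'I_k * n.+1.-tuple bool),
    exists2 h, (n < h)%N &
      forall i x, F n.+1 i x -> F n (parent (g i)) (iter h T x)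
}.

Lemma tower_exists (A : 'I_k -> set X) : continuous T ->
  (forall j, closed (A j)) -> pos_indep T A ->
  exists2 F, tower F & forall j t, F 0%N (j, t) = A j.
Proof.
move=> Tc clA posA.
pose fam n := 'I_k * n.-tuple bool -> set X.
pose good n (F : fam n) := (forall i, closed (F i)) /\ pos_indep T F.
pose next n (F : fam n) (F' : fam n.+1) := [/\ good n.+1 F',
  forall i, F' i `<=` F (parent i),
  forall i x y, F' i x -> F' i y -> rho x y <= n.+1%:R^-1 &
  forall g : 'I_k * n.+1.-tuple bool -> 'I_k * n.+1.-tuple bool,
    exists2 h, (n < h)%N &
      forall i x, F' i x -> F (parent (g i)) (iter h T x)].
have step n : {f : fam n -> fam n.+1 & forall F, good n F -> next n F (f F)}.
  apply: (@choice (fam n) (fam n.+1) (fun F F' => good n F -> next n F F')) => F.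
  have [[clF posF]|nF] := pselect (good n F); last by exists (fun=> setT).
  have e0 : 0 < n.+1%:R^-1 :> R by rewrite invr_gt0 ltr0n.
  have [||F' [clF' posF' subF' diamF' retF']] :=
    pos_indep_refine rhoP Xcompact Tc (A := F \o @parent k n) n e0.
  - by move=> i; apply: clF.
  - by apply: (pos_indep_sub (f := @parent k n) _ posF) => i x.
  by exists F'.
pose F := nat_rect fam (fun i => A i.1) (fun n Fn => projT1 (step n) Fn).
have Fgood n : good n (F n).
  elim: n => [|n IH]; last by have [] := projT2 (step n) _ IH.
  split=> [i|]; first exact: clA.
  by apply: (pos_indep_sub (f := fst) _ posA) => i x.
have Fnext n : next n (F n) (F n.+1) := projT2 (step n) _ (Fgood n).
exists F => //; split => n; try by have [] := Fnext n.
- by have [] := Fgood n.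
- by have [] := Fgood n.
Qed.

Variable F : forall n, 'I_k * n.-tuple bool -> set X.
Arguments F : clear implicits.
Hypothesis FT : tower F.

Lemma tower_root n i : F n i `<=` F 0%N (i.1, [tuple]).
Proof.
elim: n i => [|n IH] [j t] x; first by rewrite (tuple0 t).
by move=> /(tower_parent FT) /IH.
Qed.

Lemma tower_prefix_mono j c m n : (m <= n)%N ->
  F n (j, prefix_rev c n) `<=` F m (j, prefix_rev c m).
Proof.
elim: n => [|n IH]; first by rewrite leqn0 => /eqP ->.
rewrite leq_eqVlt => /predU1P[->//|mn] x /(tower_parent FT).
by rewrite parent_prefix; exact: IH.
Qed.

(* Two different nodes are moved, at a common time, to the disjoint sets
   above [a] and [b]. *)
Lemma tower_disjoint a b n i i' x :
  F 0%N (a, [tuple]) `&` F 0%N (b, [tuple]) = set0 ->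
  F n.+1 i x -> F n.+1 i' x -> i = i'.
Proof.
move=> ab0 Fi Fi'; apply: contrapT => ii'.
pose t0 := [tuple of nseq n.+1 false].
have [h _ hP] := tower_return FT (fun l => if l == i then (a, t0) else (b, t0)).
have := hP _ _ Fi; have := hP _ _ Fi'.
rewrite eqxx; case: eqP => [e|_]; first by case: ii'.
move=> /tower_root /= Fb /tower_root /= Fa.
by have : set0 (iter h T x) by rewrite -ab0.
Qed.

(** A cluster point of points chosen in the nested closed sets along a branch lies in all of
    them. *)
Lemma tower_point : exists pt : 'I_k -> cantor_space -> X,
  forall j c n, F n (j, prefix_rev c n) (pt j c).
Proof.
suff H (jc : 'I_k * cantor_space) :
    exists x, forall n, F n (jc.1, prefix_rev jc.2 n) x.
  by have [f fP] := choice H; exists (fun j c => f (j, c)) => j c n; exact: (fP (j, c) n).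
case: jc => j c /=.
have /choice[u uP] : forall n, exists x, F n (j, prefix_rev c n) x.
  by move=> n; exact: pos_indep_nonempty (tower_pos FT n).
have [p [_ clp]] := @Xcompact (u @ \oo) _ filterT.
exists p => n; apply: (tower_closed FT) => B pB.
apply: clp => //; exists n => // m /= nm; exact: tower_prefix_mono nm _ (uP m).
Qed.

Variable pt : 'I_k -> cantor_space -> X.
Hypothesis ptP : forall j c n, F n (j, prefix_rev c n) (pt j c).

Lemma tower_nbhs j c U : nbhs (pt j c) U ->
  exists N, forall n, (N <= n)%N -> F n (j, prefix_rev c n) `<=` U.
Proof.
move=> /(nbhs_metricP rhoP)[e e0 eU].
exists (Num.truncn e^-1).+1 => n Nn x /(tower_prefix_mono Nn) Fx.
apply: eU => /=.
have := tower_diam FT (ptP j c (Num.truncn e^-1).+1) Fx.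
move=> /le_lt_trans; apply.
by rewrite -[ltRHS]invrK ltf_pV2 ?posrE ?invr_gt0 ?ltr0n // truncnS_gt.
Qed.

Lemma tower_point_continuous j : continuous (pt j).
Proof.
move=> c U /tower_nbhs[N /(_ N (leqnn N)) NU].
rewrite /fmap /=; apply: filterS (nbhs_prefix_rev c N) => c' /= e.
by apply: NU; rewrite -e.
Qed.

(** Equal points force equal nodes at every level by [tower_disjoint], and the nodes determine the
    code. *)
Lemma tower_point_inj a b j j' c c' :
  F 0%N (a, [tuple]) `&` F 0%N (b, [tuple]) = set0 ->
  pt j c = pt j' c' -> j = j' /\ c = c'.
Proof.
move=> ab0 e.
have H n : (j, prefix_rev c n.+1) = (j', prefix_rev c' n.+1).
  by apply: (tower_disjoint ab0 (ptP j c n.+1)); rewrite e.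
split; first by have [] := H 0%N.
apply: prefix_rev_inj => n; apply: (prefix_rev_mono (leqnSn n)).
exact: (congr1 snd (H n)).
Qed.

End Tower.

(** * The lower limit and the final assembly *)

Lemma limn_einf_eq0 (R : realType) (u : nat -> R) : (forall n, 0 <= u n) ->
  (forall e, 0 < e -> forall N, exists2 n, (N <= n)%N & u n <= e) ->
  limn_einf (fun n => (u n)%:E) = 0%E.
Proof.
move=> u0 uP; rewrite limn_einf_lim.
rewrite (_ : einfs _ = cst 0%E); first exact: lim_cst.
apply/funext => N; rewrite /einfs /=; apply/eqP; rewrite eq_le; apply/andP; split.
  apply/lee_addgt0Pr => e e0; have [n Nn une] := uP e e0 N.
  rewrite add0e; apply: (@le_trans _ _ (u n)%:E); last by rewrite lee_fin.
  by apply: ereal_inf_lbound; exists n.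
by apply: le_ereal_inf_tmp => _ [n _ <-]; rewrite lee_fin.
Qed.

Theorem theorem3p18 (R : realType) (isZ : bool) (X : topologicalType)
    (rho : X -> X -> R) (T Tinv : X -> X) (k : nat)
    (x : 'I_k -> X) (A : 'I_k -> set X) :
  is_compatible_metric rho ->
  compact [set: X] ->
  continuous T ->
  (forall y : X, exists x0 : X, T x0 = y) ->
  (isZ -> [/\ cancel T Tinv, cancel Tinv T & continuous Tinv]) ->
  (2 <= k)%N ->
  (exists i j, x i <> x j) ->
  IE_tuple R T Tinv isZ x ->
  (forall j, nbhs (x j) (A j)) ->
  exists2 delta : R, 0 < delta &
  exists Z : 'I_k -> set X,
    (forall j, is_cantor_set (Z j) /\ Z j `<=` A j) /\
    let Zu := \bigcup_(j in [set: 'I_k]) Z j in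
    (forall (l : nat) (y : 'I_l -> X), (0 < l)%N ->
        (forall i, Zu (y i)) -> IE_tuple R T Tinv isZ y) /\
    (forall (m : nat) (y y' : 'I_m -> X), (0 < m)%N ->
        injective y -> (forall i, Zu (y i)) -> (forall i, Zu (y' i)) ->
        limn_einf (fun n : nat =>
          ((\big[Num.max/0]_(i < m) rho (iter n T (y i)) (y' i))%:E)) = 0%E).
Proof.
move=> rhoP Xc Tc _ TK _ [a [b xab]] IEx Anbhs.
(* Radii of at most a third of the distance keep the closed balls around [x a] and [x b]
   disjoint. *)
have r0 : 0 < rho (x a) (x b) / 3 by rewrite divr_gt0 // (cmetric_gt0 rhoP).
have /choice[e eP] : forall j, exists e : R,
    [/\ 0 < e, e <= rho (x a) (x b) / 3 & [set z | rho (x j) z <= e] `<=` A j].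
  move=> j; have /(nbhs_metricP rhoP)[e e0 eA] := Anbhs j.
  exists (Num.min (e / 2) (rho (x a) (x b) / 3)); split.
  - by rewrite lt_min divr_gt0.
  - by rewrite ge_min lexx orbT.
  by move=> z /= ze; apply: eA; move: ze; rewrite /= le_min => /andP[]; lra.
pose B j := [set z | rho (x j) z <= e j].
have posB : pos_indep T B.
  have [|J [BJ Jd]] := IEx B.
    move=> j; apply/(nbhs_metricP rhoP); exists (e j); first by have [] := eP j.
    by move=> z /ltW.
  by apply: (positive_density_pos_indep (x a) _ BJ Jd) => /TK[].
have clB j : closed (B j) by apply: (closed_metric_ball rhoP).
have [F FT F0] := tower_exists rhoP Xc Tc clB posB.
have ab0 : F 0%N (a, [tuple]) `&` F 0%N (b, [tuple]) = set0.
  rewrite !F0 -subset0 => z; rewrite /B /= => -[az bz].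
  have [_ ea _] := eP a; have [_ eb _] := eP b.
  have := cmetric_triangle rhoP (x a) z (x b).
  by rewrite (cmetric_sym rhoP z (x b)); move: r0; lra.
have [pt ptP] := tower_point Xc FT.
exists 1 => //; exists (fun j => range (pt j)); split.
  move=> j; split.
    apply: is_cantor_set_range; first exact: (cmetric_hausdorff rhoP).
      exact: (@tower_point_continuous _ _ _ _ _ rhoP _ FT _ ptP j).
    by move=> c c' /(tower_point_inj FT ptP ab0)[].
  move=> _ [c _ <-]; have [_ _] := eP j; apply.
  by have := ptP j c 0%N; rewrite F0.
move=> Zu.
have code l (y : 'I_l -> X) : (forall i, Zu (y i)) ->
    exists jc : 'I_l -> 'I_k * cantor_space, forall i, y i = pt (jc i).1 (jc i).2.
  move=> yZ; have /choice[jc jcP] : forall i, exists jc, y i = pt jc.1 jc.2.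
    by move=> i; have [j _ [c _ <-]] := yZ i; exists (j, c).
  by exists jc.
pose node (jc : 'I_k * cantor_space) n := (jc.1, prefix_rev jc.2 n).
have ptnode jc n : F n (node jc n) (pt jc.1 jc.2) by apply: ptP.
split=> [l y l0 /code[jc yE] U Uy|m y y' m0 yinj /code[jc yE] /code[jc' yE']].
  have /choice[N NP] : forall i, exists N, forall n, (N <= n)%N ->
      F n (node (jc i) n) `<=` U i.
    move=> i; apply: (tower_nbhs rhoP FT ptP); rewrite -yE; exact: Uy.
  apply: pos_indep_positive_density.
  apply: (pos_indep_sub (f := fun i => node (jc i) (\max_i N i))) (tower_pos FT _).
  by move=> i; apply: NP; apply: leq_bigmax.
(* Distinct points get different nodes from some level on, so [g] below can prescribe their images
   independently. *)
have /choice[N NP] : forall p : 'I_m * 'I_m, exists N, forall n, (N <= n)%N ->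
    node (jc p.1) n = node (jc p.2) n -> p.1 = p.2.
  move=> [i i'] /=; apply: contrapT => H; apply: (H); exists 0%N => n _ _.
  apply: yinj; rewrite !yE; suff -> : jc i = jc i' by [].
  have nodeE N : node (jc i) N = node (jc i') N.
    apply: contrapT => nE; apply: H; exists N => {}n Nn [ej en]; exfalso.
    by apply: nE; congr pair => //; apply: prefix_rev_mono Nn en.
  rewrite [jc i]surjective_pairing [jc i']surjective_pairing.
  congr pair; first exact: (congr1 fst (nodeE 0%N)).
  by apply: prefix_rev_inj => {}n; exact: (congr1 snd (nodeE n)).
apply: limn_einf_eq0 => [n|d d0 n].
  by elim/big_ind: _ => // [u v u0 v0|i _]; rewrite ?le_max ?u0 // (cmetric_ge0 rhoP).
pose M := maxn n (maxn (\max_p N p) (Num.truncn d^-1)).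
have nM : (n <= M)%N by rewrite leq_maxl.
have NM p : (N p <= M.+2)%N.
  apply: leq_trans (leqW (leqnSn M)).
  by rewrite /M !leq_max leq_bigmax orbT.
have dM : M.+1%:R^-1 <= d.
  rewrite -[leRHS]invrK lef_pV2 ?posrE ?invr_gt0 ?ltr0n //.
  rewrite ltW // (lt_le_trans (truncnS_gt _)) // ler_nat ltnS.
  by rewrite /M !leq_max leqnn !orbT.
(* Level M + 2 is used because the return lands at level M + 1, in a set of diameter at most 1 / (M
   + 1) that also contains the target point. *)
pose g z := if [pick i | node (jc i) M.+2 == z] is Some i
  then node (jc' i) M.+2 else z.
have gE i : g (node (jc i) M.+2) = node (jc' i) M.+2.
  rewrite /g; case: pickP => [i' /eqP ei|/(_ i)]; last by rewrite eqxx.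
  by have /= -> := NP (i', i) _ (NM _) ei.
have [h Mh hP] := tower_return FT g.
exists h; first by rewrite (leq_trans nM) // ltnW // ltnW.
elim/big_ind: _ => [|u v ud vd|i _]; first exact: ltW.
  by rewrite ge_max ud.
apply: le_trans dM; apply: (tower_diam FT (i := node (jc' i) M.+1)).
  by have := hP _ _ (ptnode (jc i) M.+2); rewrite gE parent_prefix -yE.
by rewrite yE'; exact: ptnode.
Qed.
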